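(* Let $\Sigma\mathsf{Dcpo}$ denote the class of all dcpos endowed with their Scott topologies, and let $\Sigma\mathsf{ADcpo}$, $\Sigma\mathsf{CDcpo}$ and $\Sigma\mathsf{QCDcpo}$ denote respectively the subclasses of algebraic dcpos, continuous dcpos and quasicontinuous dcpos, all with their Scott topologies. Then $$\mathbf{Top}_{\Sigma\mathsf{ADcpo}}=\mathbf{Top}_{\Sigma\mathsf{CDcpo}}=\mathbf{Top}_{\Sigma\mathsf{QCDcpo}}=\mathbf{Top}_{\Sigma\mathsf{Dcpo}}.$$
   Context: All spaces are $T_0$; $\mathbf{Top}$ is the category of $T_0$ spaces and continuous maps. For a class $\mathbb C$ of $T_0$ spaces, a subset $U$ of a space $X$ is $\mathbb C$-open if $k^{-1}(U)$ is open in $C$ for every $C\in\mathbb C$ and every continuous map $k:C\to X$; $X$ is $\mathbb C$-generated if every $\mathbb C$-open subset is open; $\mathbf{Top}_{\mathbb C}$ is the full subcategory of $\mathbf{Top}$ of $\mathbb C$-generated spaces. A dcpo is a poset in which every (non-empty) directed subset has a supremum. The Scott topology consists of the upper sets $U$ such that every directed $D$ with $\sup D\in U$ meets $U$. Algebraic, continuous and quasicontinuous dcpos have their standard meanings in domain theory; a dcpo $P$ is continuous iff its Scott space is a $c$-space (for every open $U$ and $x\in U$ there is $y\in U$ with $x\in\mathrm{int}(\uparrow y)$), and $P$ is quasicontinuous iff its Scott space is locally hypercompact (for every open $U$ and $x\in U$ there is a finite $F$ with $x\in\mathrm{int}(\uparrow F)\subseteq\uparrow F\subseteq U$). *)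

(* Defs.v *)
From HB Require Import structures.
From mathcomp Require Import all_boot all_order.
From mathcomp Require Import all_classical.
From mathcomp Require Import topology_structure separation_axioms.

Set Implicit Arguments.
Unset Strict Implicit.
Unset Printing Implicit Defensive.

Import Order.TTheory.

Local Open Scope order_scope.
Local Open Scope classical_set_scope.

Definition directed (T : Type) (R : T -> T -> Prop) (D : set T) : Prop :=
  D !=set0 /\
  forall x y, D x -> D y -> exists z, [/\ D z, R x z & R y z].

Section domains.
Context {d : Order.disp_t} (P : porderType d).
Implicit Types (x y s : P) (D F G U : set P).

Definition le_directed : set P -> Prop := directed (fun x y => x <= y).

(* [P] may be empty, and need not have a least element. *)
Definition dcpo : Prop := forall D, le_directed D -> exists s, isLub D s.

Definition way_below x y : Prop :=
  forall D s, le_directed D -> isLub D s -> y <= s ->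
  exists2 z, D z & x <= z.

Definition compact_element x : Prop := way_below x x.

Definition algebraic_dcpo : Prop := dcpo /\
  forall x, let K := [set y | compact_element y /\ y <= x] in
            le_directed K /\ isLub K x.

Definition continuous_dcpo : Prop := dcpo /\
  forall x, let W := [set y | way_below y x] in
            le_directed W /\ isLub W x.

Definition up F : set P := [set y | exists2 x, F x & x <= y].

Definition set_way_below F G : Prop :=
  forall D s, le_directed D -> isLub D s -> up G s ->
  exists2 z, D z & up F z.

(* The Smyth preorder: larger sets in this preorder have smaller upper
   closures. *)
Definition smyth_le F G : Prop := G `<=` up F.

(* Nonemptiness of the finite sets need not be required: the empty set is way
   below no singleton, as the directed set [[set x]] shows. *)
Definition fin_way_below x : set (set P) :=
  [set F | finite_set F /\ set_way_below F [set x]].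

Definition quasicontinuous_dcpo : Prop := dcpo /\
  forall x, directed smyth_le (fin_way_below x) /\
            forall y, ~ (x <= y) -> exists2 F, fin_way_below x F & ~ up F y.

Definition scott_open U : Prop :=
  (forall x y, U x -> x <= y -> U y) /\
  (forall D s, le_directed D -> isLub D s -> U s -> D `&` U !=set0).

Lemma scott_openT : scott_open setT.
Proof. by split=> // D s [[x Dx] _] _ _; exists x. Qed.

Lemma scott_openI : setI_closed scott_open.
Proof.
move=> U V [Uup Uacc] [Vup Vacc]; split=> [x y [Ux Vx] xy|D s Ddir Ds [Us Vs]].
  by split; [exact: Uup xy|exact: Vup xy].
have [x [Dx Ux]] := Uacc D s Ddir Ds Us.
have [y [Dy Vy]] := Vacc D s Ddir Ds Vs.
have [z [Dz xz yz]] := Ddir.2 x y Dx Dy.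
by exists z; split=> //; split; [exact: Uup xz|exact: Vup yz].
Qed.

Lemma scott_open_bigU (I : Type) (f : I -> set P) :
  (forall i, scott_open (f i)) -> scott_open (\bigcup_i f i).
Proof.
move=> fo; split=> [x y [i _ fx] xy|D s Ddir Ds [i _ fs]].
  by exists i => //; exact: (fo i).1 xy.
have [x [Dx fx]] := (fo i).2 D s Ddir Ds fs.
by exists x; split=> //; exists i.
Qed.

(* The carrier of [P], equipped with the Scott topology. *)
Definition scott : Type := P.

HB.instance Definition _ := Choice.on scott.
HB.instance Definition _ := isOpenTopological.Build scott
  scott_openT scott_openI scott_open_bigU.

Lemma scott_openE U : open (U : set scott) = scott_open U.
Proof. by []. Qed.

End domains.

Lemma scott_kolmogorov d (P : porderType d) : kolmogorov_space (scott P).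
Proof.
have sep (x y : P) : ~~ (x <= y) ->
    exists A : set (scott P), A \in nbhs (x : scott P) /\ y \in ~` A.
  move=> xy; exists [set z : P | ~~ (z <= y)]; split; last first.
    by rewrite inE => /negP; apply.
  rewrite inE; apply: open_nbhs_nbhs; split=> //; rewrite scott_openE.
  split=> [a b /= ay ab|D s Ddir [_ Ds] /= sy].
    by apply: contraNN ay; exact: le_trans.
  apply: contrapT => D0; move/negP: sy; apply; apply: Ds => z Dz.
  by apply: contrapT => zy; apply: D0; exists z; split=> //; apply/negP.
move=> x y xy.
have : ~~ ((x : P) <= y) || ~~ ((y : P) <= x).
  by rewrite -negb_and; apply: contra_neqN xy => /le_anti.
by case/orP => /sep[A HA]; exists A; [left|right].
Qed.

(* Classes of spaces are predicates on [topologicalType]; a full subcategory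
   of the category of T0 spaces is identified with its class of objects. *)
Definition space_class := topologicalType -> Prop.

Definition class_open (C : space_class) (X : topologicalType) (U : set X) :
    Prop :=
  forall Y : topologicalType, C Y ->
  forall k : Y -> X, continuous k -> open (k @^-1` U).

Definition class_generated (C : space_class) (X : topologicalType) : Prop :=
  forall U : set X, class_open C U -> open U.

Definition Top_ (C : space_class) : space_class :=
  fun X => kolmogorov_space X /\ class_generated C X.

Definition Sigma (K : forall d, porderType d -> Prop) : space_class :=
  fun X => exists (d : Order.disp_t) (P : porderType d),
    K d P /\ X = (scott P : topologicalType).

Definition SigmaDcpo : space_class := Sigma (@dcpo).
Definition SigmaADcpo : space_class := Sigma (@algebraic_dcpo).
Definition SigmaCDcpo : space_class := Sigma (@continuous_dcpo).
Definition SigmaQCDcpo : space_class := Sigma (@quasicontinuous_dcpo).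

(* Main.v *)
From HB Require Import structures.
From mathcomp Require Import all_boot all_order.
From mathcomp Require Import all_classical.
From mathcomp Require Import topology_structure separation_axioms.
Require Import Defs.

Set Implicit Arguments.
Unset Strict Implicit.
Unset Printing Implicit Defensive.

Import Order.TTheory.

Local Open Scope order_scope.
Local Open Scope classical_set_scope.

(** Enlarging a class [C] of spaces can only enlarge the class of [C]-generated
spaces, and every algebraic dcpo is continuous, every continuous dcpo is
quasicontinuous, and every quasicontinuous dcpo is a dcpo.  This gives three
inclusions, and it remains to see that a space generated by all dcpos is
already generated by the algebraic ones.

The reason is that the Scott space of a dcpo [P] is a quotient of the Scott
space of an algebraic dcpo, namely of the poset of ideals of [P], where the
quotient map sends an ideal to its supremum ([scott_open_preimage_ideal_sup]).
This map preserves directed suprema, hence is continuous.  Conversely, let the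
set of ideals with supremum in [U] be Scott open.  Principal ideals show that
[U] is an upper set; and if [D] is directed with supremum in [U], then the
ideal generated by [D] is the directed supremum of the principal ideals of the
elements of [D], so that one of these has its supremum, an element of [D], in
[U].  So each Scott space of a dcpo is generated by algebraic dcpos, and this
property passes to the spaces that are generated by such spaces
([class_generated_trans]). *)

(** * Algebraic, continuous and quasicontinuous dcpos *)

Section classes_of_dcpos.
Context {d : Order.disp_t} (P : porderType d).
Implicit Types (x y z : P) (D F : set P).

Lemma compact_way_below x y z :
  compact_element y -> z <= y -> y <= x -> way_below z x.
Proof.
move=> cy zy yx D s Ddir Ds xs.
have [w Dw yw] := cy D s Ddir Ds (le_trans yx xs).
by exists w => //; exact: le_trans yw.
Qed.

(** As [x] is the directed supremum of the compact elements below it, these are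
cofinal among the elements way below [x]; so the latter are directed too, with
the same supremum. *)
Lemma algebraic_continuous : algebraic_dcpo P -> continuous_dcpo P.
Proof.
move=> [dP alg]; split=> // x W.
have [Kdir [Kub Klub]] := alg x.
have WK w : W w -> exists k, [/\ compact_element k, k <= x & w <= k].
  move=> /(_ _ _ Kdir (conj Kub Klub) (lexx x))[k [ck kx] wk].
  by exists k.
have KW k : compact_element k -> k <= x -> W k.
  by move=> ck kx; exact: compact_way_below (lexx k) kx.
split; first split.
- by have [k [ck kx]] := Kdir.1; exists k; exact: KW.
- move=> a b /WK[k [ck kx ak]] /WK[l [cl lx bl]].
  have [m [[cm mx] km lm]] := Kdir.2 k l (conj ck kx) (conj cl lx).
  by exists m; split; [exact: KW|exact: le_trans km|exact: le_trans lm].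
- split=> [w /WK[k [_ kx wk]]|b Wb]; first exact: le_trans kx.
  by apply: Klub => k [ck kx]; apply: Wb; exact: KW.
Qed.

Lemma way_below_fin_way_below x y : way_below y x -> fin_way_below x [set y].
Proof.
move=> yx; split=> [|D s Ddir Ds [_ -> xs]]; first exact: finite_set1.
by have [z Dz yz] := yx D s Ddir Ds xs; exists z => //; exists y.
Qed.

(** Applying [set_way_below] to the directed set of the elements way below [x]
shows that the singletons of these elements are cofinal among the finite sets
way below [x]. *)
Lemma continuous_quasicontinuous :
  continuous_dcpo P -> quasicontinuous_dcpo P.
Proof.
move=> [dP cont]; split=> // x.
have [Wdir Wlub] := cont x.
have Wcof F : fin_way_below x F -> exists2 w, way_below w x & up F w.
  by move=> [_ /(_ _ _ Wdir Wlub)]; apply; exists x.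
split; first split.
- have [w wx] := Wdir.1.
  by exists [set w]; exact: way_below_fin_way_below.
- move=> F G /Wcof[a ax [a' Fa' a'a]] /Wcof[b bx [b' Gb' b'b]].
  have [c [cx ac bc]] := Wdir.2 a b ax bx.
  exists [set c]; split; first exact: way_below_fin_way_below.
  + by move=> _ ->; exists a' => //; exact: le_trans ac.
  + by move=> _ ->; exists b' => //; exact: le_trans bc.
- move=> y xy; apply: contrapT => noF; apply: xy.
  apply: Wlub.2 => w wx; apply: contrapT => wy; apply: noF.
  exists [set w]; first exact: way_below_fin_way_below.
  by move=> [_ -> ].
Qed.

End classes_of_dcpos.

(** * The algebraic dcpo of ideals of a poset *)

Section ideals.
Context {d : Order.disp_t} (P : porderType d).
Implicit Types (x y : P) (D : set P).

Definition is_ideal D : Prop :=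
  le_directed D /\ forall x y, D y -> x <= y -> D x.

Definition ideal : Type := {D : set P | `[< is_ideal D >]}.

HB.instance Definition _ := SubChoice.on ideal.
HB.instance Definition _ := 
  [SubChoice_isSubPOrder of ideal by <: with Order.Disp tt tt].

Implicit Types (I J : ideal) (E : set ideal).

Lemma idealP I : is_ideal (val I).
Proof. exact/asboolP/(valP I). Qed.

Lemma ideal_leP I J : I <= J <-> val I `<=` val J.
Proof. by rewrite leEsub subsetEset. Qed.

Lemma is_ideal_down D : le_directed D -> is_ideal (down D).
Proof.
move=> [[x Dx] Ddir]; split; first split.
- by exists x; apply/downP; exists x.
- move=> a b /downP[a' Da' aa'] /downP[b' Db' bb'].
  have [c [Dc ac bc]] := Ddir a' b' Da' Db'.
  exists c; split; first by apply/downP; exists c.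
    exact: le_trans ac.
  exact: le_trans bc.
- move=> a b /downP[c Dc bc] ab; apply/downP.
  by exists c => //; exact: le_trans bc.
Qed.

Definition ideal_of D (Ddir : le_directed D) : ideal :=
  exist _ (down D) (introT (asboolP _) (is_ideal_down Ddir)).

Lemma le_directed1 x : le_directed [set x].
Proof. by split=> [|_ _ -> ->]; exists x. Qed.

Definition principal_ideal x : ideal := ideal_of (le_directed1 x).

Lemma mem_principal_ideal x y : val (principal_ideal x) y <-> y <= x.
Proof. by split=> [/downP[_ -> ]|yx] //; apply/downP; exists x. Qed.

Lemma principal_ideal_le I x : principal_ideal x <= I <-> val I x.
Proof.
split=> [/ideal_leP|Ix]; first by apply; exact/mem_principal_ideal.
apply/ideal_leP => y /mem_principal_ideal; exact: (idealP I).2.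
Qed.

Lemma principal_ideal_homo x y :
  x <= y -> principal_ideal x <= principal_ideal y.
Proof. by move=> xy; apply/principal_ideal_le/mem_principal_ideal. Qed.

Lemma le_directed_principal_ideal D :
  le_directed D -> le_directed (principal_ideal @` D).
Proof.
move=> [[x Dx] Ddir]; split; first by exists (principal_ideal x); exists x.
move=> _ _ [a Da <-] [b Db <-]; have [c [Dc ac bc]] := Ddir a b Da Db.
by exists (principal_ideal c); split; [by exists c|..]; exact: principal_ideal_homo.
Qed.

Lemma ideal_of_lub D (Ddir : le_directed D) :
  isLub (principal_ideal @` D) (ideal_of Ddir).
Proof.
split=> [_ [x Dx <-]|I Iub].
  by apply/principal_ideal_le/downP; exists x.
apply/ideal_leP => x /downP[y Dy xy]; apply: (idealP I).2 xy.
by apply/principal_ideal_le/Iub; exists y.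
Qed.

Lemma ideal_lub I : isLub (principal_ideal @` val I) I.
Proof.
split=> [_ [x Ix <-]|J Jub]; first exact/principal_ideal_le.
by apply/ideal_leP => x Ix; apply/principal_ideal_le/Jub; exists x.
Qed.

Lemma is_ideal_bigcup E : le_directed E -> is_ideal (\bigcup_(I in E) val I).
Proof.
move=> [[I EI] Edir]; split; first split.
- by have [x Ix] := (idealP I).1.1; exists x; exists I.
- move=> a b [J EJ Ja] [K EK Kb].
  have [L [EL /ideal_leP JL /ideal_leP KL]] := Edir J K EJ EK.
  have [c [Lc ac bc]] := (idealP L).1.2 a b (JL a Ja) (KL b Kb).
  by exists c; split=> //; exists L.
- by move=> a b [J EJ Jb] ab; exists J => //; exact: (idealP J).2 ab.
Qed.

Definition ideal_bigcup E (Edir : le_directed E) : ideal :=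
  exist _ (\bigcup_(I in E) val I) (introT (asboolP _) (is_ideal_bigcup Edir)).

Lemma ideal_bigcup_lub E (Edir : le_directed E) :
  isLub E (ideal_bigcup Edir).
Proof.
split=> [I EI|J Jub]; first by apply/ideal_leP => x Ix; exists I.
by apply/ideal_leP => x [I EI Ix]; exact: (ideal_leP I J).1 (Jub I EI) x Ix.
Qed.

Lemma ideal_dcpo : dcpo ideal.
Proof. by move=> E Edir; exists (ideal_bigcup Edir); exact: ideal_bigcup_lub. Qed.

(** The union of a directed family of ideals is an ideal, so any supremum of the
family is contained in it. *)
Lemma mem_ideal_lub E I x : le_directed E -> isLub E I -> val I x ->
  exists2 J, E J & val J x.
Proof.
move=> Edir [_ Ilub] Ix.
have /ideal_leP : I <= ideal_bigcup Edir.
  by apply: Ilub; exact: (ideal_bigcup_lub Edir).1.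
by move=> /(_ x Ix)[J EJ Jx]; exists J.
Qed.

Lemma principal_ideal_compact x : compact_element (principal_ideal x).
Proof.
move=> E I Edir Ilub /principal_ideal_le Ix.
have [J EJ Jx] := mem_ideal_lub Edir Ilub Ix.
by exists J => //; exact/principal_ideal_le.
Qed.

(** An ideal is the directed supremum of its principal subideals, so a compact
one lies below, and hence equals, one of them. *)
Lemma compact_idealE I :
  compact_element I <-> exists x, I = principal_ideal x.
Proof.
split=> [cI|[x ->]]; last exact: principal_ideal_compact.
have Idir := le_directed_principal_ideal (idealP I).1.
have [_ [x Ix <-] Ilex] := cI _ _ Idir (ideal_lub I) (lexx I).
by exists x; apply/le_anti; rewrite Ilex; exact/principal_ideal_le.
Qed.

Lemma ideal_algebraic : algebraic_dcpo ideal.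
Proof.
split; first exact: ideal_dcpo.
move=> I K; suff -> : K = principal_ideal @` val I.
  split; last exact: ideal_lub.
  exact: le_directed_principal_ideal (idealP I).1.
apply/seteqP; split=> [_ [/compact_idealE[x ->] /principal_ideal_le Ix]|].
  by exists x.
move=> _ [x Ix <-]; split; first exact: principal_ideal_compact.
exact/principal_ideal_le.
Qed.

End ideals.

(** * The supremum map from the ideals of a dcpo *)

Section ideal_sup.
Context {d : Order.disp_t} (P : porderType d) (dP : dcpo P).
Implicit Types (x y : P) (D U : set P) (I J : ideal P) (E : set (ideal P)).

Definition ideal_sup I : P := projT1 (cid (dP (idealP I).1)).

Lemma ideal_sup_lub I : isLub (val I) (ideal_sup I).
Proof. exact: projT2 (cid (dP (idealP I).1)). Qed.

Lemma isLub_unique D x y : isLub D x -> isLub D y -> x = y.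
Proof.
move=> [xub xlub] [yub ylub]; apply/le_anti.
by rewrite (xlub y yub) (ylub x xub).
Qed.

Lemma ideal_sup_homo I J : I <= J -> ideal_sup I <= ideal_sup J.
Proof.
move=> /ideal_leP IJ; apply: (ideal_sup_lub I).2 => x /IJ.
exact: (ideal_sup_lub J).1.
Qed.

Lemma ideal_sup_ideal_of D (Ddir : le_directed D) x :
  isLub D x -> ideal_sup (ideal_of Ddir) = x.
Proof.
move=> [xub xlub]; apply: isLub_unique (ideal_sup_lub _) _.
split=> [y /downP[z Dz yz]|b bub]; first exact: le_trans yz (xub z Dz).
by apply: xlub => y Dy; apply: bub; apply/downP; exists y.
Qed.

Lemma ideal_sup_principal x : ideal_sup (principal_ideal x) = x.
Proof.
apply: ideal_sup_ideal_of.
by split=> [_ -> //|b]; apply.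
Qed.

Lemma le_directed_ideal_sup E : le_directed E -> le_directed (ideal_sup @` E).
Proof.
move=> [[I EI] Edir]; split; first by exists (ideal_sup I); exists I.
move=> _ _ [J EJ <-] [K EK <-]; have [L [EL JL KL]] := Edir J K EJ EK.
by exists (ideal_sup L); split; [by exists L|..]; exact: ideal_sup_homo.
Qed.

Lemma ideal_sup_isLub E I : le_directed E -> isLub E I ->
  isLub (ideal_sup @` E) (ideal_sup I).
Proof.
move=> Edir Ilub; split=> [_ [J EJ <-]|b bub].
  exact: ideal_sup_homo (Ilub.1 J EJ).
apply: (ideal_sup_lub I).2 => x Ix.
have [J EJ Jx] := mem_ideal_lub Edir Ilub Ix.
by apply: le_trans ((ideal_sup_lub J).1 x Jx) (bub _ _); exists J.
Qed.

(** In topological terms, [ideal_sup] is a quotient map of Scott spaces: it is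
continuous because it preserves directed suprema, and each directed set [D] of
[P] lifts along it to the directed set of principal ideals of the elements of
[D], whose supremum is the ideal generated by [D]. *)
Lemma scott_open_preimage_ideal_sup U :
  scott_open (ideal_sup @^-1` U) <-> scott_open U.
Proof.
split=> [] [Uup Uacc].
  split=> [x y Ux xy|D s Ddir Ds Us].
    rewrite -(ideal_sup_principal y).
    apply: (Uup _ _ _ (principal_ideal_homo xy)).
    by rewrite /preimage /= ideal_sup_principal.
  have [|_ [[x Dx <-]]] := Uacc _ _ (le_directed_principal_ideal Ddir)
                                (ideal_of_lub Ddir).
    by rewrite /preimage /= (ideal_sup_ideal_of Ddir Ds).
  by rewrite /preimage /= ideal_sup_principal => Ux; exists x.
split=> [I J UI IJ|E I Edir Ilub UI]; first exact: Uup (ideal_sup_homo IJ).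
have [_ [[J EJ <-] UJ]] := Uacc _ _ (le_directed_ideal_sup Edir)
                                (ideal_sup_isLub Edir Ilub) UI.
by exists J.
Qed.

Lemma scott_class_generated_algebraic :
  class_generated SigmaADcpo (scott P).
Proof.
move=> U Uopen; rewrite scott_openE; apply/scott_open_preimage_ideal_sup.
apply: (Uopen (scott (ideal P)) _ ideal_sup).
  by exists _, (ideal P); split=> //; exact: ideal_algebraic.
by apply/continuousP => V /scott_open_preimage_ideal_sup.
Qed.

End ideal_sup.

(** * Generated spaces *)

Lemma class_generated_sub (C C' : space_class) (X : topologicalType) :
  (forall Y, C Y -> C' Y) -> class_generated C X -> class_generated C' X.
Proof.
by move=> CC' genX U Uopen; apply: genX => Y CY; exact: Uopen (CC' Y CY).
Qed.

(** The preimage of a [C]-open set under a continuous map is [C]-open, since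
continuous maps compose. *)
Lemma class_generated_trans (C C' : space_class) (X : topologicalType) :
  (forall Y, C' Y -> class_generated C Y) ->
  class_generated C' X -> class_generated C X.
Proof.
move=> genC' genX U Uopen; apply: genX => Y C'Y k kcont.
apply: genC' => // Z CZ h hcont; apply: (Uopen Z CZ (k \o h)).
by move=> z; apply: continuous_comp; [exact: hcont|exact: kcont].
Qed.

Lemma eq_Top (C C' : space_class) :
  (forall X, class_generated C X <-> class_generated C' X) ->
  Top_ C = Top_ C'.
Proof.
move=> CC'; apply/funext => X; apply/propext.
by split=> [] [T0X /CC'].
Qed.

Lemma Sigma_sub (K K' : forall d, porderType d -> Prop) :
  (forall d (P : porderType d), K d P -> K' d P) ->
  forall X, Sigma K X -> Sigma K' X.
Proof.
by move=> KK' X [d [P [KP XP]]]; exists d, P; split=> //; exact: KK'.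
Qed.

Theorem theorem41 :
  Top_ SigmaADcpo = Top_ SigmaCDcpo /\
  Top_ SigmaCDcpo = Top_ SigmaQCDcpo /\
  Top_ SigmaQCDcpo = Top_ SigmaDcpo.
Proof.
have AC := class_generated_sub (Sigma_sub (@algebraic_continuous)).
have CQ := class_generated_sub (Sigma_sub (@continuous_quasicontinuous)).
have QD : forall X, class_generated SigmaQCDcpo X ->
    class_generated SigmaDcpo X.
  by move=> X; apply: class_generated_sub; apply: Sigma_sub => d P [].
have DA : forall X, class_generated SigmaDcpo X ->
    class_generated SigmaADcpo X.
  move=> X; apply: class_generated_trans => _ [d [P [dP ->]]].
  exact: scott_class_generated_algebraic.
split; [|split]; apply: eq_Top => X; split=> genX.
- exact: AC.
- exact/DA/QD/CQ.
- exact: CQ.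
- exact/AC/DA/QD.
- exact: QD.
- exact/CQ/AC/DA.
Qed.
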